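(* Let $G$ be a simple connected graph on $n$ vertices having a dominating vertex $i$ (i.e. $d_i=n-1$), and let $\lambda_1\ge\cdots\ge\lambda_n$ be the eigenvalues of its normalized adjacency matrix $D^{-1}A$. Then $$-2-\frac{2}{n-1}+\min_{k\neq i}\Big\{\frac{1}{d_k}+\frac{2d_k}{n-1}\Big\}\le\lambda_n\le\lambda_2\le 2-\min_{k\neq i}\Big\{\frac{1}{d_k}+\frac{2d_k}{n-1}\Big\}.$$
   Context: $d_k$ denotes the degree of vertex $k$. $A$ is the adjacency matrix, $D$ the diagonal degree matrix, and $D^{-1}A$ the normalized adjacency matrix (with real eigenvalues). *)

(* Defs.v *)
From HB Require Import structures.
From mathcomp Require Import all_boot all_order all_algebra.
Set Implicit Arguments.
Unset Strict Implicit.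
Unset Printing Implicit Defensive.
Import Order.TTheory GRing.Theory Num.Theory.
Local Open Scope ring_scope.

(* A simple graph on n vertices is a symmetric irreflexive relation on 'I_n. *)

Definition connected_graph n (e : rel 'I_n) : Prop :=
  forall x y : 'I_n, connect e x y.

Definition degree n (e : rel 'I_n) (k : 'I_n) : nat := #|[set j | e k j]|.

Definition adjmx (R : pzSemiRingType) n (e : rel 'I_n) : 'M[R]_n :=
  \matrix_(k, j) (e k j)%:R.

Definition degmx (R : pzSemiRingType) n (e : rel 'I_n) : 'M[R]_n :=
  diag_mx (\row_k (degree e k)%:R).

(* When some degree is 0 the degree matrix is singular and invmx returns it
   unchanged; this cannot occur in a connected graph with n >= 2. *)
Definition normalized_adjmx (R : comUnitRingType) n (e : rel 'I_n) : 'M[R]_n :=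
  invmx (degmx R e) *m adjmx R e.

(* lam lists all the eigenvalues of M, with algebraic multiplicity, in
   nonincreasing order; indices are shifted, lam`_j being the (j+1)-st
   largest eigenvalue. *)
Definition eigenvalues_desc (R : rcfType) n (M : 'M[R]_n) (lam : n.-tuple R) :
  Prop :=
  sorted >=%R lam /\ char_poly M = \prod_(a <- lam) ('X - a%:P).

(* R has no top element to serve as the neutral element of min, so the
   iteration starts from the first value of the family (min is idempotent);
   the junk value for an empty family is 0. *)
Definition min_over (R : rcfType) (I : finType) (P : pred I) (F : I -> R) : R :=
  let s := [seq F k | k <- enum P] in
  \big[Num.min/head 0 s]_(x <- s) x.

Lemma min_overP (R : rcfType) (I : finType) (P : pred I) (F : I -> R) (k0 : I) :
  P k0 ->
  (exists2 k, P k & min_over P F = F k) /\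
  (forall k, P k -> min_over P F <= F k).
Proof.
move=> Pk0; rewrite /min_over.
set s := [seq F k | k <- enum P].
have Fs k : P k -> F k \in s by move=> Pk; apply: map_f; rewrite mem_enum.
have hs : head 0 s \in s.
  by have := Fs _ Pk0; case: (s) => // a t _; rewrite mem_head.
split.
  suff: \big[Num.min/head 0 s]_(x <- s) x \in s.
    by case/mapP=> k; rewrite mem_enum => Pk ->; exists k.
  rewrite big_seq; apply: (big_ind (fun x => x \in s)) => // x y xs ys.
  by rewrite minEle; case: ifP.
move=> k /Fs; elim: (s) (head 0 s) => // a t IH b.
rewrite big_cons inE ge_min => /orP[/eqP->|/IH ->]; by rewrite ?lexx ?orbT.
Qed.

(* Main.v *)
Require Import Defs.
From HB Require Import structures.
From mathcomp Require Import all_boot all_order all_algebra.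
From mathcomp Require Import ring lra.
Import Order.TTheory GRing.Theory Num.Theory.
Local Open Scope ring_scope.

(* Subtracting row i from the other rows of a matrix with unit row sums and
   deleting row and column i removes one eigenvalue 1. For the normalized
   adjacency matrix and a dominating vertex i, the resulting matrix has
   diagonal entries -1/(n-1), and its Gershgorin discs give both bounds. *)

Definition deflated_mx {R : pzRingType} {p} (i : 'I_p.+1) (M : 'M[R]_p.+1) :
    'M[R]_p :=
  \matrix_(k, j) (M (lift i k) (lift i j) - M i (lift i j)).

Lemma char_poly_deflated (R : comNzRingType) p (i : 'I_p.+1) (M : 'M[R]_p.+1) :
  (forall k, \sum_j M k j = 1) ->
  char_poly M = ('X - 1) * char_poly (deflated_mx i M).
Proof.
move=> M1.
(* [V] is the identity with column [i] replaced by the all-ones vector, an eigenvector of [M] for 1.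
   [N] is [M] in that basis: its column [i] is a unit vector, and outside row and column [i] it is
   the deflated matrix. *)
pose V : 'M[R]_p.+1 := \matrix_(k, j) (if j == i then 1 else (k == j)%:R).
pose N : 'M[R]_p.+1 := \matrix_(k, j)
  (if j == i then (k == i)%:R else if k == i then M i j else M k j - M i j).
have MV : M *m V = V *m N.
  apply/matrixP=> k j; rewrite !mxE.
  have [->|ji] := eqVneq j i.
    rewrite (eq_bigr (M k)); last by move=> l _; rewrite mxE eqxx mulr1.
    rewrite M1 (bigD1 i) //= !mxE !eqxx mulr1 big1 ?addr0 // => l li.
    by rewrite !mxE eqxx (negbTE li) mulr0.
  rewrite (bigD1 j) //= big1 => [|l lj]; last first.
    by rewrite mxE (negbTE ji) (negbTE lj) mulr0.
  rewrite mxE (negbTE ji) eqxx mulr1 addr0 (bigD1 i) //= !mxE eqxx (negbTE ji).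
  have [->|ki] := eqVneq k i.
    rewrite mul1r big1 ?addr0 // => l li.
    by rewrite !mxE (negbTE li) eq_sym (negbTE li) mul0r.
  rewrite (bigD1 k) //= !mxE (negbTE ki) eqxx (negbTE ji).
  rewrite big1 => [|l /andP[li lk]].
    by rewrite addr0 !mul1r addrC subrK.
  by rewrite !mxE (negbTE li) eq_sym (negbTE lk) mul0r.
(* Row [i] of [V] is a unit vector, and the complementary minor is the identity. *)
have detV : \det V = 1.
  rewrite (expand_det_row V i) (bigD1 i) //= big1 => [|j ji]; last first.
    by rewrite mxE (negbTE ji) eq_sym (negbTE ji) mul0r.
  rewrite mxE eqxx mul1r addr0 /cofactor addnn -signr_odd odd_double mul1r.
  rewrite -[RHS](det1 R p); congr (\det _).
  apply/matrixP=> k j; rewrite !mxE (inj_eq lift_inj).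
  by rewrite eq_sym (negbTE (neq_lift _ _)).
have -> : char_poly M = char_poly N.
  (* Similarity lifts to the characteristic matrices, since scalar matrices commute with [V]; taking
     determinants avoids inverting [V]. *)
  have VC : char_poly_mx M *m map_mx polyC V = map_mx polyC V *m char_poly_mx N.
    by rewrite mulmxBl mulmxBr -!map_mxM MV scalar_mxC.
  have := congr1 determinant VC; rewrite !det_mulmx det_map_mx detV.
  by rewrite mulr1 mul1r.
rewrite /char_poly (expand_det_col _ i) (bigD1 i) //= big1 => [|k ki]; last first.
  by rewrite !mxE eqxx (negbTE ki) mulr0n subr0 mul0r.
rewrite !mxE !eqxx addr0 mulr1n; congr (_ * _).
rewrite /cofactor addnn -signr_odd odd_double mul1r row'_col'_char_poly_mx.
congr (\det (char_poly_mx _)); apply/matrixP=> k j; rewrite !mxE.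
by rewrite ![lift i _ == i]eq_sym !(negbTE (neq_lift _ _)).
Qed.

Lemma char_poly_tr (R : comNzRingType) n (B : 'M[R]_n) :
  char_poly B^T = char_poly B.
Proof.
rewrite /char_poly -det_tr; congr (\det _).
by apply/matrixP=> k j; rewrite !mxE eq_sym.
Qed.

(** The index [k] is where an eigenvector is largest in absolute value: dividing the [k]-th
    eigenvalue equation by that coordinate leaves ratios of absolute value at most 1. *)
Lemma gershgorin (R : realFieldType) n (B : 'M[R]_n) (a : R) :
  root (char_poly B) a ->
  exists k, `|a - B k k| <= \sum_(j | j != k) `|B k j|.
Proof.
(* [eigenvalue] concerns row vectors, so the transpose is used to obtain sums along the rows of
   [B]. *)
rewrite -char_poly_tr -eigenvalue_root_char => /eigenvalueP[v vB /rV0Pn[k0 vk0]].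
pose k := [arg max_(l > k0) `|v 0 l|]%O.
have v_max l : `|v 0 l| <= `|v 0 k|.
  by rewrite /k; case: arg_maxP => //= x _; apply.
have vk_gt0 : 0 < `|v 0 k| by rewrite (lt_le_trans _ (v_max k0)) ?normr_gt0.
exists k; rewrite -(ler_pM2r vk_gt0) -normrM.
have -> : (a - B k k) * v 0 k = \sum_(j | j != k) B k j * v 0 j.
  have := congr1 (fun w : 'rV_n => w 0 k) vB; rewrite !mxE (bigD1 k) //= !mxE.
  rewrite mulrBl => <-; rewrite [B k k * _]mulrC addrAC subrr add0r.
  by apply: eq_bigr => j _; rewrite mxE mulrC.
rewrite mulr_suml (le_trans (ler_norm_sum _ _ _)) //.
by apply: ler_sum => j _; rewrite normrM ler_wpM2l.
Qed.

Lemma degree_sum n (e : rel 'I_n) k : degree e k = (\sum_j e k j)%N.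
Proof.
rewrite /degree -sum1_card big_mkcond; apply: eq_bigr => j _.
by rewrite inE; case: (e k j).
Qed.

(** Without loops, the neighbours of [i] lie in the complement of [i], and the degree makes the two
    sets equal in size. *)
Lemma dominating_adj n (e : rel 'I_n) i j :
  irreflexive e -> degree e i = n.-1 -> j != i -> e i j.
Proof.
move=> e_irr i_dom ji.
have sub : [set l | e i l] \subset [set~ i].
  by apply/subsetP=> l; rewrite !inE; apply: contraTneq => ->; rewrite e_irr.
suff /eqP/setP/(_ j) : [set l | e i l] == [set~ i] by rewrite !inE ji.
by rewrite eqEcard sub cardsC1 card_ord -i_dom leqnn.
Qed.

Lemma degree_gt0 p (e : rel 'I_p.+2) i :
  symmetric e -> irreflexive e -> degree e i = p.+1 ->
  forall l, (0 < degree e l)%N.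
Proof.
move=> e_sym e_irr i_dom l.
have [->|li] := eqVneq l i; first by rewrite i_dom.
by rewrite /degree (cardD1 i) inE e_sym (dominating_adj _ e).
Qed.

Lemma normalized_adjmxE (R : numFieldType) n (e : rel 'I_n) :
  (forall k, (0 < degree e k)%N) ->
  forall k j, normalized_adjmx R e k j = (e k j)%:R / (degree e k)%:R.
Proof.
move=> d_gt0 k j.
have d_neq0 l : (degree e l)%:R != 0 :> R by rewrite pnatr_eq0 -lt0n.
have D_unit : degmx R e \in unitmx.
  rewrite unitmxE det_diag unitfE; apply/prodf_neq0 => l _.
  by rewrite mxE.
have := congr1 (fun X : 'M_n => X k j) (mulKVmx D_unit (adjmx R e)).
rewrite -/(normalized_adjmx R e) mul_diag_mx !mxE => <-.
by rewrite mulrAC mulfV ?mul1r.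
Qed.

(** Off the diagonal, row [k] has [d - 1] entries [1/d - 1/(n-1)], from the neighbours other than
    [i], and [n - 1 - d] entries [-1/(n-1)]. Here [n - 1] is [p.+1]. *)
Lemma deflated_radius (R : realFieldType) p (e : rel 'I_p.+2) (i : 'I_p.+2) :
    symmetric e -> irreflexive e -> degree e i = p.+1 ->
  forall k : 'I_p.+1,
  let B := deflated_mx i (normalized_adjmx R e) in
  let d : R := (degree e (lift i k))%:R in
  B k k = - (1 / p.+1%:R) /\
  \sum_(j | j != k) `|B k j| = 2 - (1 / d + 2 * d / p.+1%:R) + 1 / p.+1%:R.
Proof.
move=> e_sym e_irr i_dom k B d.
have adj j : e i (lift i j) by rewrite (dominating_adj _ e) // eq_sym neq_lift.
have d_gt0 := degree_gt0 _ e i e_sym e_irr i_dom.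
have BE j : B k j = (e (lift i k) (lift i j))%:R / d - 1 / p.+1%:R.
  by rewrite mxE !normalized_adjmxE // i_dom adj.
have d_pos : 0 < d by rewrite ltr0n.
have p_pos : 0 < p.+1%:R :> R by rewrite ltr0n.
have d_sum : d = 1 + \sum_j (e (lift i k) (lift i j))%:R.
  rewrite /d degree_sum natr_sum (bigD1_ord i) //= e_sym adj.
  by congr (_ + _).
(* This makes the entries [1/d - 1/(n-1)] at neighbours nonnegative. *)
have d_le : d <= p.+1%:R.
  rewrite ler_nat /degree -[p.+1]/(p.+2.-1) -[p.+2 in leqRHS]card_ord.
  rewrite -(cardsC1 (lift i k)) subset_leq_card //.
  by apply/subsetP=> l; rewrite !inE; apply: contraTneq => ->; rewrite e_irr.
have Bkk : B k k = - (1 / p.+1%:R) by rewrite BE e_irr mul0r sub0r.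
split=> //.
(* Both cases are merged into one expression affine in the adjacency indicator, so that the row sum
   depends only on [d]. *)
have absB j : `|B k j| =
    (e (lift i k) (lift i j))%:R * (1 / d - 2 / p.+1%:R) + 1 / p.+1%:R.
  rewrite BE; case: (e _ _) => /=.
    rewrite ger0_norm; first by ring.
    by rewrite subr_ge0 !mul1r lef_pV2.
  by rewrite !mul0r sub0r normrN ger0_norm ?divr_ge0 ?add0r // ltW.
have := congr1 (fun x => x - `|B k k|)
  (eq_bigr (fun j => _) (fun j _ => absB j) : \sum_j `|B k j| = _).
rewrite [in LHS](bigD1 k) //= addrAC subrr add0r => ->.
rewrite big_split /= -mulr_suml sumr_const card_ord.
have -> : \sum_j (e (lift i k) (lift i j))%:R = d - 1 :> R.
  by rewrite d_sum addrAC subrr add0r.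
rewrite absB e_irr -[1 / _ *+ _]mulr_natr mul0r add0r.
by field; rewrite !gt_eqF // -mulrS.
Qed.

Theorem theorem4p5 (R : rcfType) (n : nat) (hn : (1 < n)%N)
  (e : rel 'I_n) (e_sym : symmetric e) (e_irr : irreflexive e)
  (e_conn : connected_graph e)
  (i : 'I_n) (i_dom : degree e i = n.-1)
  (lam : n.-tuple R)
  (lamE : eigenvalues_desc (normalized_adjmx R e) lam) :
  let m := min_over (fun k : 'I_n => k != i)
    (fun k => 1 / (degree e k)%:R + 2 * (degree e k)%:R / (n%:R - 1)) in
  [/\ - 2 - 2 / (n%:R - 1) + m <= lam`_n.-1,
      lam`_n.-1 <= lam`_1
    & lam`_1 <= 2 - m].
Proof.
case: n hn e e_sym e_irr e_conn i i_dom lam lamE => [|[|p]] // _.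
move=> e e_sym e_irr _ i i_dom lam [lam_sorted lamE] m.
have pE : p.+2%:R - 1 = p.+1%:R :> R by rewrite [p.+2%:R]mulrS addrAC subrr add0r.
have p_pos : 0 < p.+1%:R :> R by rewrite ltr0n.
have m_le k : m <= 1 / (degree e (lift i k))%:R
    + 2 * (degree e (lift i k))%:R / p.+1%:R.
  rewrite -pE /m; set F := (X in min_over _ X).
  have ki : lift i k != i by rewrite eq_sym neq_lift.
  have [_ minF] := min_overP F (ki : (fun k0 => k0 != i) (lift i k)).
  exact: minF.
rewrite pE; set M := normalized_adjmx R e in lamE.
have d_gt0 := degree_gt0 _ e i e_sym e_irr i_dom.
have M1 k : \sum_j M k j = 1.
  rewrite (eq_bigr (fun j => (e k j)%:R / (degree e k)%:R)); last first.
    by move=> j _; apply: normalized_adjmxE.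
  by rewrite -mulr_suml -natr_sum -degree_sum divff // pnatr_eq0 -lt0n.
have := char_poly_deflated _ _ i M M1; rewrite lamE.
set B := deflated_mx i M => lamB.
have lam1 : 1 \in lam by rewrite -root_prod_XsubC lamB rootM root_XsubC eqxx.
(* Cancelling ['X - 1] shows that [rem 1 lam] lists the eigenvalues of [B]. Each lies in a disc with
   centre [-1/(n-1)] and radius [2 - D + 1/(n-1)], where [D >= m]. *)
have B_bounds a : a \in rem 1 (lam : seq R) ->
    - 2 - 2 / p.+1%:R + m <= a <= 2 - m.
  move=> a_rem; have [k] : exists k, `|a - B k k| <= \sum_(j | j != k) `|B k j|.
    apply: gershgorin; suff <- : \prod_(x <- rem 1 lam) ('X - x%:P) = char_poly B.
      by rewrite root_prod_XsubC.
    have : 'X - 1 != 0 :> {poly R} by rewrite polyXsubC_eq0.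
    move/mulfI; apply; rewrite -lamB (perm_big _ (perm_to_rem lam1)).
    by rewrite big_cons.
  have [-> ->] := deflated_radius R p e i e_sym e_irr i_dom k.
  move: (m_le k); rewrite ler_norml /= opprK.
  move: (1 / _ + _) => D; move: (p.+1%:R^-1) => q mD /andP[lo hi].
  by apply/andP; split; clearbody m; lra.
have lam_le (j l : nat) : (j <= l < p.+2)%N -> lam`_l <= lam`_j.
  move=> /andP[jl lp]; have jp := leq_ltn_trans jl lp.
  apply: (sorted_leq_nth _ _ _ lam_sorted); rewrite ?inE ?size_tuple //.
    by move=> x y z yx zy; apply: le_trans yx.
  by move=> x; apply: lexx.
split.
(* If the last entry is not an eigenvalue of [B], it equals 1. Any eigenvalue of [B], which exists
   as [n >= 2], shows that the lower bound is at most [2 - m]; hence [m <= 2 + 1/(n-1)], and the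
   lower bound is below 1. *)
- have [|lam_last] := boolP (lam`_p.+1 \in rem 1 (lam : seq R)).
    by case/B_bounds/andP.
  have last1 : lam`_p.+1 = 1.
    have : lam`_p.+1 \in (lam : seq R) by rewrite mem_nth ?size_tuple.
    by rewrite (perm_mem (perm_to_rem lam1)) inE (negbTE lam_last) orbF => /eqP.
  have /B_bounds/andP[lo hi] : (rem 1 (lam : seq R))`_0 \in rem 1 (lam : seq R).
    by rewrite mem_nth // size_rem // size_tuple.
  have q_pos : 0 < p.+1%:R^-1 :> R by rewrite invr_gt0.
  move: q_pos lo hi; rewrite last1; clearbody m.
  by move: p.+1%:R^-1 => q; lra.
- by apply: lam_le; rewrite /= ltnSn.
(* [rem] drops the first occurrence of 1. If that is the head, the second entry survives; otherwise
   the head survives and dominates the second entry. *)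
- have [lam0|lam0] := eqVneq (lam`_0) 1.
    suff /B_bounds/andP[] : lam`_1 \in rem 1 (lam : seq R) by [].
    case: (lam : seq R) (size_tuple lam) lam0 => [|a0 [|a1 s]] //= _ ->.
    by rewrite eqxx mem_head.
  suff /B_bounds/andP[_] : lam`_0 \in rem 1 (lam : seq R).
    by apply: le_trans; rewrite lam_le.
  case: (lam : seq R) (size_tuple lam) lam0 => [|a0 s] //= _ /negbTE ->.
  exact: mem_head.
Qed.
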